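(* Let $G$ be a connected graph with a distinguished vertex (root) $r$. If for any two vertices $u,v$ of $G$ there exists a pseudo-median of size $1$ of the triple $(u,v,r)$, then every daisy graph of $G$ with respect to $r$ is an isometric subgraph of $G$.
   Context: Distances $d_G$ are shortest-path distances, and $I_G(a,b)=\{x\in V(G): d_G(a,x)+d_G(x,b)=d_G(a,b)\}$ is the interval. A subgraph $H$ of $G$ is isometric if $d_H(a,b)=d_G(a,b)$ for all $a,b\in V(H)$. For $X\subseteq V(G)$, the daisy graph $G_r(X)$ of $G$ with respect to $r$ (generated by $X$) is the subgraph of $G$ induced by $\bigcup_{v\in X} I_G(r,v)$; a daisy graph of $G$ with respect to $r$ is any $G_r(X)$ with $X\subseteq V(G)$. A triple $(x,y,z)$ of vertices of $G$ is a pseudo-median of the triple $(u,v,w)$ if: (1) there is a shortest $u,v$-path containing both $x$ and $y$, a shortest $v,w$-path containing both $y$ and $z$, and a shortest $u,w$-path containing both $x$ and $z$; (2) $d(x,y)=d(y,z)=d(x,z)$; (3) $d(x,y)$ is minimal subject to (1) and (2). The number $d(x,y)$ is the size of the pseudo-median. *)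

(* Defs.v *)
From mathcomp Require Import all_boot.
From mathcomp Require Import boolp classical_sets.

Set Implicit Arguments.
Unset Strict Implicit.
Unset Printing Implicit Defensive.

Local Open Scope classical_set_scope.

(* Simple undirected graphs, not necessarily finite. *)
Record sgraph := SGraph {
  vertex :> choiceType;
  adj : rel vertex;
  adj_sym : symmetric adj;
  adj_irr : irreflexive adj }.

(* The vertices of a path from u are u :: p, so that its length is size p. *)
Definition upath (G : sgraph) (u v : G) (p : seq G) : bool :=
  [&& path (@adj G) u p, last u p == v & uniq (u :: p)].

Definition connected (G : sgraph) : Prop :=
  forall u v : G, exists p, upath u v p.

(* The junk value 0 for vertices in different components does no harm in
   isometric below: d_G(a,b) = 0 with a, b in one component forces a = b
   (see isometric_connected). *)
Definition dist (G : sgraph) (u v : G) : nat :=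
  match pselect (exists n, `[< exists2 p, upath u v p & size p = n >]) with
  | left h => ex_minn h
  | right _ => 0
  end.

Definition shortest_path (G : sgraph) (u v : G) (p : seq G) : Prop :=
  upath u v p /\ size p = dist u v.

Definition interval (G : sgraph) (a b : G) : set G :=
  [set x | dist a x + dist x b = dist a b].

Record subgraph (G : sgraph) := Subgraph {
  sub_vertices : set G;
  sub_adj : rel G;
  sub_adj_sym : symmetric sub_adj;
  sub_adjP : forall x y, sub_adj x y ->
    [/\ sub_vertices x, sub_vertices y & adj x y] }.

Section SubgraphAsGraph.
Variables (G : sgraph) (H : subgraph G).

Let sadj : rel (set_type (sub_vertices H)) :=
  fun x y => sub_adj H (\val x) (\val y).

Let sadj_sym : symmetric sadj.
Proof. by move=> x y; apply: sub_adj_sym. Qed.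

Let sadj_irr : irreflexive sadj.
Proof.
by move=> x; apply/negP => /sub_adjP[_ _]; rewrite adj_irr.
Qed.

Definition graph_of_subgraph : sgraph := SGraph sadj_sym sadj_irr.

End SubgraphAsGraph.

Definition isometric (G : sgraph) (H : subgraph G) : Prop :=
  forall a b : graph_of_subgraph H, dist a b = dist (\val a) (\val b).

Section Induced.
Variables (G : sgraph) (S : set G).

Let iadj : rel G := fun x y => [&& x \in S, y \in S & adj x y].

Let iadj_sym : symmetric iadj.
Proof. by move=> x y; rewrite /iadj adj_sym andbCA. Qed.

Let iadjP x y : iadj x y -> [/\ S x, S y & adj x y].
Proof. by case/and3P=> /set_mem ? /set_mem ? ?. Qed.

Definition induced : subgraph G := Subgraph iadj_sym iadjP.

End Induced.

Definition daisy (G : sgraph) (r : G) (X : set G) : subgraph G :=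
  induced (\bigcup_(v in X) interval r v).

Definition pseudo_median_cond (G : sgraph) (u v w x y z : G) : Prop :=
  [/\ exists p, [/\ shortest_path u v p, x \in u :: p & y \in u :: p],
      exists p, [/\ shortest_path v w p, y \in v :: p & z \in v :: p],
      exists p, [/\ shortest_path u w p, x \in u :: p & z \in u :: p],
      dist x y = dist y z & dist y z = dist x z].

Definition pseudo_median (G : sgraph) (u v w x y z : G) : Prop :=
  pseudo_median_cond u v w x y z /\
  forall x' y' z', pseudo_median_cond u v w x' y' z' -> dist x y <= dist x' y'.

Section Sanity.
Variable G : sgraph.

Lemma distP (u v : G) :
  (exists p, upath u v p) -> exists p, shortest_path u v p.
Proof.
rewrite /shortest_path /dist => -[p up].
case: pselect => [h|[]]; last by exists (size p); apply/asboolP; exists p.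
by case: ex_minnP => n /asboolP[q uq sq] _; exists q.
Qed.

Lemma distvv (u : G) : dist u u = 0.
Proof.
rewrite /dist; case: pselect => // h; case: ex_minnP => n _ /(_ 0) le.
apply/eqP; rewrite -leqn0; apply: le; apply/asboolP.
by exists [::] => //; rewrite /upath /= eqxx.
Qed.

Lemma isometric_connected (H : subgraph G) :
  connected G -> isometric H -> connected (graph_of_subgraph H).
Proof.
move=> cG isoH a b; apply: contrapT => nab.
have d0 : dist a b = 0.
  rewrite /dist; case: pselect => // h.
  by case: nab; have [n /asboolP[p up _]] := h; exists p.
have [p [/and3P[_ /eqP ab _]]] := distP (cG (\val a) (\val b)).
rewrite -isoH d0 => /size0nil p0; rewrite p0 /= in ab.
by case: nab; exists [::]; rewrite /upath /= andbT; apply/eqP/val_inj.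
Qed.

(* "Size 1" for the triples (u,v,r) has to be read as "size at most 1":
   pseudo-medians of degenerate triples always have size 0. *)
Lemma pseudo_median_degenerate (r x y z : G) :
  pseudo_median r r r x y z -> dist x y = 0.
Proof.
case=> -[[p [[_]]]]; rewrite distvv => /size0nil ->.
by rewrite !inE => /eqP-> /eqP-> _ _ _ _ _; rewrite distvv.
Qed.

End Sanity.

(* Main.v *)
Require Import Defs.
From mathcomp Require Import all_boot.
From mathcomp Require Import boolp classical_sets.
From mathcomp Require Import zify.

(** The vertex set [S] of a daisy graph is a union of intervals [I(r,u)], so it
    contains [I(r,u)] as soon as it contains [u].  Let [(x,y,z)] be a
    pseudo-median of size at most 1 of [(u,v,r)] with [u, v] in [S]; then [x]
    lies in [I(u,r)] and [y] in [I(v,r)].  If [x] precedes [y] on a geodesic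
    from [u] to [v], then [I(u,x)], [{x,y}] and [I(y,v)] lie in [S], so [S]
    contains a geodesic from [u] to [v] through [x] and [y].  Otherwise [y] is
    in [I(u,x)], hence in [I(u,r)], so [I(u,y)] and [I(y,v)] both lie in [S]
    and [S] contains a geodesic from [u] to [v] through [y]. *)

Set Implicit Arguments.
Unset Strict Implicit.
Unset Printing Implicit Defensive.

Local Open Scope classical_set_scope.

Section Distance.
Variable G : sgraph.
Implicit Types (u v w x y : G) (p : seq G).

(** Deleting the cycles of a walk leaves a path that is no longer. From here on walks can replace
    paths, and [uniq] need not be checked for concatenations and reversals. *)
Lemma dist_le_walk u v p :
  path (@adj G) u p -> last u p = v -> dist u v <= size p.
Proof.
move=> pp lp; case: (shortenP pp) lp => q qp qu sub lq.
have uq : upath u v q by rewrite /upath qp qu lq eqxx.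
apply: (@leq_trans (size q)); last first.
  by apply: uniq_leq_size => //; case/andP: qu.
rewrite /dist; case: pselect => // h; case: ex_minnP => n _; apply.
by apply/asboolP; exists q.
Qed.

Hypothesis connG : connected G.

Lemma geodesicP u v :
  exists p, [/\ path (@adj G) u p, last u p = v & size p = dist u v].
Proof. by have [p [/and3P[? /eqP ? _] ?]] := distP (connG u v); exists p. Qed.

Lemma dist_triangle v u w : dist u w <= dist u v + dist v w.
Proof.
have [p [pp lp <-]] := geodesicP u v; have [q [pq lq <-]] := geodesicP v w.
by rewrite -size_cat; apply: dist_le_walk; rewrite ?cat_path ?last_cat lp ?pp.
Qed.

Lemma dist_sym_le u v : dist v u <= dist u v.
Proof.
have [p [pp lp <-]] := geodesicP u v.
(* The walk back is [rev (belast u p)]: a walk is listed without its starting vertex, so v is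
   dropped and u kept. *)
rewrite -(size_belast u) -size_rev; apply: dist_le_walk.
  by rewrite -lp rev_path (eq_path (e' := @adj G)) // => a b; rewrite adj_sym.
by case: p lp {pp} => [|a p] //= ; rewrite rev_cons last_rcons.
Qed.

Lemma distC u v : dist u v = dist v u.
Proof. by apply/eqP; rewrite eqn_leq !dist_sym_le. Qed.

Lemma dist0_eq u v : dist u v = 0 -> u = v.
Proof.
by have [p [_ lp sp]] := geodesicP u v => d0; move: sp lp; rewrite d0; case: p.
Qed.

Lemma intervalC u v : interval u v = interval v u.
Proof.
apply/seteqP; split=> x; rewrite /interval /=.
  by rewrite addnC distC [dist u x]distC [dist u v]distC.
by rewrite addnC distC [dist v x]distC [dist v u]distC.
Qed.

Lemma interval_subset u v w :
  interval u v w -> interval u w `<=` interval u v.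
Proof.
rewrite /interval /= => uvw x /= uwx.
have := dist_triangle x u v; have := dist_triangle w x v; lia.
Qed.

Lemma interval_dist_le1 u v x :
  dist u v <= 1 -> interval u v x -> x = u \/ x = v.
Proof.
rewrite /interval /= => uv1 uvx.
have [/dist0_eq->|d0] := posnP (dist u x); first by left.
by right; apply: dist0_eq; lia.
Qed.

(** With m the cut vertex, the pieces have lengths at least d(u,m) and d(m,v), and d(u,m) + d(m,v)
    is at least d(u,v), the total length. Hence all these inequalities are equalities. *)
Lemma geodesic_cat u v p q :
  path (@adj G) u (p ++ q) -> last u (p ++ q) = v ->
  size (p ++ q) = dist u v ->
  dist u (last u p) = size p /\ interval u v (last u p).
Proof.
rewrite cat_path last_cat size_cat /interval /= => /andP[pp pq] lq sz.
have := dist_le_walk pp erefl; have := dist_le_walk pq lq.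
have := dist_triangle (last u p) u v; lia.
Qed.

Lemma geodesic_interval u v p x :
  path (@adj G) u p -> last u p = v -> size p = dist u v ->
  x \in u :: p -> interval u v x.
Proof.
move=> + + + xp; case/splitPl: xp => p1 p2 <- pp lp sp.
by have [] := geodesic_cat pp lp sp.
Qed.

Lemma shortest_path_interval u v p x :
  shortest_path u v p -> x \in u :: p -> interval u v x.
Proof. by case=> /and3P[pp /eqP lp _] sp; exact: geodesic_interval. Qed.

Lemma shortest_path_order u v p x y :
  shortest_path u v p -> x \in u :: p -> y \in u :: p ->
  (interval u v y /\ interval u y x) \/ (interval u v x /\ interval u x y).
Proof.
move=> up xp yp; have uvx := shortest_path_interval up xp.
have uvy := shortest_path_interval up yp.
case: up => /and3P[pp /eqP lp _] sp.
case/splitPl: xp yp pp lp sp => p1 p2 lx.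
rewrite -cat_cons mem_cat => yp pp lp sp.
have [dp1 _] := geodesic_cat pp lp sp.
(* The geodesic is cut at x, and y lies either on the initial piece [u :: p1] or on the tail [p2],
   each piece being a geodesic. *)
case/orP: yp => yp.
  right; split=> //; apply: (geodesic_interval (p := p1)) => //.
    by move: pp; rewrite cat_path => /andP[].
  by rewrite -lx.
left; split=> //; move: uvx uvy; rewrite /interval /= => uvx uvy.
have xvy : interval x v y.
  move: pp lp sp; rewrite cat_path last_cat size_cat lx => /andP[_ pp] lp sp.
  apply: (geodesic_interval pp lp); last by rewrite inE yp orbT.
  by rewrite lx in dp1; lia.
move: xvy; rewrite /interval /=; lia.
Qed.

Definition geodesic_in (S : set G) u v : Prop :=
  exists p, [/\ path (@adj G) u p, last u p = v, size p = dist u v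
              & forall x, x \in u :: p -> S x].

Lemma geodesic_in_interval (S : set G) u v :
  interval u v `<=` S -> geodesic_in S u v.
Proof.
move=> IS; have [p [pp lp sp]] := geodesicP u v.
by exists p; split=> // x xp; apply: IS; exact: geodesic_interval xp.
Qed.

Lemma geodesic_in_cat (S : set G) u v w :
  interval u w v -> geodesic_in S u v -> geodesic_in S v w ->
  geodesic_in S u w.
Proof.
rewrite /interval /= => uwv [p [pp lp sp pS]] [q [pq lq sq qS]].
exists (p ++ q); split.
- by rewrite cat_path pp lp.
- by rewrite last_cat lp.
- by rewrite size_cat sp sq.
- move=> x; rewrite -cat_cons mem_cat => /orP[/pS//|xq].
  by apply: qS; rewrite inE xq orbT.
Qed.

End Distance.

(** Vertices of the subgraph carry a membership proof, so a walk of G inside S is lifted one vertex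
    at a time. *)
Lemma induced_walk (G : sgraph) (S : set G)
    (a : graph_of_subgraph (induced S)) (p : seq G) :
  path (@adj G) (\val a) p -> (forall x, x \in p -> S x) ->
  exists q : seq (graph_of_subgraph (induced S)),
    path (@adj _) a q /\ map \val q = p.
Proof.
elim: p a => [|x p IH] a /=; first by exists [::].
case/andP=> ax xp pS; have Sx : x \in S by apply/mem_set/pS; rewrite mem_head.
have [y yp|q [qp qE]] := IH (Sub x Sx) xp; first by apply: pS; rewrite inE yp orbT.
exists (Sub x Sx :: q); rewrite /= qE; split=> //.
by rewrite qp andbT; apply/and3P; split=> //; exact: (valP a).
Qed.

Lemma isometric_inducedP (G : sgraph) (S : set G) :
  (forall u v, S u -> S v -> geodesic_in S u v) -> isometric (induced S).
Proof.
move=> geoS a b; apply/eqP; rewrite eqn_leq; apply/andP.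
have [p [pp lp sp pS]] := geoS _ _ (set_mem (valP a)) (set_mem (valP b)).
have [x xp|q [qp qE]] := induced_walk pp; first by apply: pS; rewrite inE xp orbT.
have lq : last a q = b by apply: val_inj; rewrite -last_map qE.
split; first by rewrite -sp -qE size_map; exact: dist_le_walk.
(* The lifted walk [q] connects a to b in the subgraph, which rules out the default value 0 of
   [dist]. A shortest path of the subgraph then projects to a walk of G. *)
have [s [/and3P[ps /eqP ls _] <-]] : exists s, shortest_path a b s.
  apply: distP; case: (shortenP qp) lq => s ps us _ ls.
  by exists s; rewrite /upath ps us ls eqxx.
rewrite -(size_map \val); apply: dist_le_walk; last by rewrite last_map ls.
by apply: homo_path ps => c d /sub_adjP[].
Qed.

Theorem theorem2p3 (G : sgraph) (r : G) (hG : connected G)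
    (hpm : forall u v : G, exists x y z : G,
        pseudo_median u v r x y z /\ dist x y <= 1)
    (X : set G) :
  isometric (daisy r X).
Proof.
apply: isometric_inducedP; set S := \bigcup_(_ in _) _ => u v Su Sv.
(* If w lies in I(r,t) with t in X, then I(r,w) is contained in I(r,t). *)
have closed w : S w -> interval w r `<=` S.
  by case=> t Xt rtw x; rewrite intervalC // => rwx; exists t => //;
     exact: interval_subset rwx.
have [x [y [z [[[[p [up xp yp]] [q [vq yq _]] [s [us xs _]] _ _] _] xy1]]]] :=
  hpm u v.
have urx := shortest_path_interval hG us xs.
have vry := shortest_path_interval hG vq yq.
(* Both orders of x and y end with this segment; I(v,y) is contained in I(v,r). *)
have geo_yv : geodesic_in S y v.
  apply: geodesic_in_interval => //; rewrite intervalC //.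
  exact: subset_trans (interval_subset hG vry) (closed _ Sv).
have [[uvy uyx]|[uvx uxy]] := shortest_path_order hG up xp yp;
  apply: (@geodesic_in_cat _ _ _ y) => //.
- apply: (@geodesic_in_cat _ _ _ x) => //; apply: geodesic_in_interval => //.
    exact: subset_trans (interval_subset hG urx) (closed _ Su).
  (* The size bound enters here: I(x,y) has no vertices besides x and y. *)
  move=> t /(interval_dist_le1 hG xy1)[->|->].
    exact: closed urx.
  exact: closed vry.
(* Now y is in I(u,x); as x is in both I(u,v) and I(u,r), so is y. *)
- exact: interval_subset uxy.
- apply: geodesic_in_interval => //; apply: subset_trans (closed _ Su).
  by apply: interval_subset => //; exact: interval_subset uxy.
Qed.
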